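(* Let $\alpha: I\subset\mathbb{R}\to\mathbb{R}^3_1$ be a null curve with Frenet frame $\{V_1,V_2,V_3\}$ and nowhere zero curvatures $\kappa,\tau$. Let $f:\mathbb{R}^3_1\to\mathbb{R}$ be a smooth function which is eikonal along $\alpha$ and whose Hessian satisfies $H^f=0$. If $\alpha$ is a null $f$-eikonal helix or a null $f$-eikonal $V_2$-slant helix in $\mathbb{R}^3_1$, then $$\det\left(\nabla_{V_1}V_2,\ \nabla^2_{V_1}V_2,\ \nabla^3_{V_1}V_2\right)=0$$ holds along $\alpha$.
   Context: $\mathbb{R}^3_1$ is $\mathbb{R}^3$ with the Lorentzian metric $g(a,b)=-a_1b_1+a_2b_2+a_3b_3$, and $\nabla$ is its Levi-Civita connection; $\nabla^k_{V_1}$ denotes the $k$-fold iterated covariant derivative along $\alpha$ in the direction $V_1$. A curve $\alpha(s)$ is null if $g(\alpha',\alpha')=0$. A Cartan (Frenet) frame of a null curve $\alpha$ is a family of vector fields $V_1,V_2,V_3$ along $\alpha$ with $V_1=\alpha'$, $g(V_1,V_1)=g(V_2,V_2)=0$, $g(V_1,V_2)=1$, $g(V_1,V_3)=g(V_2,V_3)=0$, $g(V_3,V_3)=1$, satisfying $$\nabla_{V_1}V_1=\kappa V_3,\quad \nabla_{V_1}V_2=\tau V_3,\quad \nabla_{V_1}V_3=-\tau V_1-\kappa V_2,$$ where $\kappa$ and $\tau$ are called the curvature and torsion. For $f$ smooth, $\nabla f$ is the gradient with respect to $g$, $g(\nabla f,X)=X(f)$, and the Hessian is $H^f(X,Y)=g(\nabla_X(\nabla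 f),Y)$. The function $f$ is eikonal along $\alpha$ if $\|\nabla f\|=\sqrt{|g(\nabla f,\nabla f)|}$ is constant along $\alpha$. Suppose $f$ is eikonal along the null curve $\alpha$. Then $\alpha$ is a null $f$-eikonal helix if $g(\nabla f,V_1)$ is a non-zero constant along $\alpha$, and a null $f$-eikonal $V_2$-slant helix if $g(\nabla f,V_2)$ is a non-zero constant along $\alpha$. *)

(* Defs.v *)
From HB Require Import structures.
From mathcomp Require Import all_boot all_order all_algebra.
From mathcomp Require Import all_classical all_reals all_analysis.
Set Implicit Arguments.
Unset Strict Implicit.
Unset Printing Implicit Defensive.
Import Order.TTheory GRing.Theory Num.Theory.
Import numFieldNormedType.Exports.
Local Open Scope classical_set_scope.
Local Open Scope ring_scope.

(* Points and tangent vectors of R^3_1 are row vectors.  The coordinates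
   a_1, a_2, a_3 have indices 0, 1, 2, so index 0 is the timelike one. *)
Definition lorentz (R : realType) (a b : 'rV[R]_3) : R :=
  - (a 0 0 * b 0 0) + a 0 1 * b 0 1 + a 0 2%:R * b 0 2%:R.

(* The metric has constant coefficients, so its Christoffel symbols vanish in
   the standard coordinates: the Levi-Civita connection is the directional
   derivative, and along a curve it is componentwise differentiation
   (see [covD_comp]). *)
Definition nabla (R : realType) (x : 'rV[R]_3) (Y : 'rV[R]_3 -> 'rV[R]_3)
  (p : 'rV[R]_3) : 'rV[R]_3 := 'D_x Y p.

(* Covariant derivative along a curve, in the direction of its velocity, of a
   vector field W along the curve. *)
Definition covD (R : realType) (W : R -> 'rV[R]_3) : R -> 'rV[R]_3 := derive1 W.

Definition covDn (R : realType) (k : nat) (W : R -> 'rV[R]_3) :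
  R -> 'rV[R]_3 := iter k (@covD R) W.

Definition smooth_along (R : realType) (I : set R) (W : R -> 'rV[R]_3) : Prop :=
  forall (n : nat) (t : R), I t -> derivable (derive1n n W) t 1.

Definition iter_derive (R : realType) (vs : seq 'rV[R]_3) (f : 'rV[R]_3 -> R) :
  'rV[R]_3 -> R := foldr (fun v h => fun p => 'D_v h p) f vs.

Definition smooth (R : realType) (f : 'rV[R]_3 -> R) : Prop :=
  forall (vs : seq 'rV[R]_3) (p : 'rV[R]_3), differentiable (iter_derive vs f) p.

(* Raising the index of df with the Lorentzian metric changes the sign of the
   timelike component; [gradP] is the characteristic property. *)
Definition grad (R : realType) (f : 'rV[R]_3 -> R) (p : 'rV[R]_3) : 'rV[R]_3 :=
  \row_(i < 3) ((if i == 0 then -1 else 1) * 'D_(delta_mx 0 i) f p).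

Definition hessian (R : realType) (f : 'rV[R]_3 -> R) (p x y : 'rV[R]_3) : R :=
  lorentz (nabla x (grad f) p) y.

Definition null_curve (R : realType) (I : set R) (alpha : R -> 'rV[R]_3) : Prop :=
  forall t : R, I t -> lorentz (derive1 alpha t) (derive1 alpha t) = 0.

Record cartan_frame (R : realType) (I : set R) (alpha V1 V2 V3 : R -> 'rV[R]_3)
    (kappa tau : R -> R) : Prop := CartanFrame {
  frame_smooth1 : smooth_along I V1;
  frame_smooth2 : smooth_along I V2;
  frame_smooth3 : smooth_along I V3;
  frame_tangent : forall t, I t -> V1 t = derive1 alpha t;
  frame_11 : forall t, I t -> lorentz (V1 t) (V1 t) = 0;
  frame_22 : forall t, I t -> lorentz (V2 t) (V2 t) = 0;
  frame_12 : forall t, I t -> lorentz (V1 t) (V2 t) = 1;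
  frame_13 : forall t, I t -> lorentz (V1 t) (V3 t) = 0;
  frame_23 : forall t, I t -> lorentz (V2 t) (V3 t) = 0;
  frame_33 : forall t, I t -> lorentz (V3 t) (V3 t) = 1;
  frame_D1 : forall t, I t -> covD V1 t = kappa t *: V3 t;
  frame_D2 : forall t, I t -> covD V2 t = tau t *: V3 t;
  frame_D3 : forall t, I t -> covD V3 t = - tau t *: V1 t - kappa t *: V2 t }.

Definition eikonal_along (R : realType) (I : set R) (alpha : R -> 'rV[R]_3)
    (f : 'rV[R]_3 -> R) : Prop :=
  exists c : R, forall t : R, I t ->
    Num.sqrt `|lorentz (grad f (alpha t)) (grad f (alpha t))| = c.

Definition nonzero_const_along (R : realType) (I : set R) (h : R -> R) : Prop :=
  exists2 c : R, c != 0 & forall t : R, I t -> h t = c.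

Definition null_eikonal_helix (R : realType) (I : set R)
    (alpha V1 : R -> 'rV[R]_3) (f : 'rV[R]_3 -> R) : Prop :=
  [/\ null_curve I alpha, eikonal_along I alpha f &
      nonzero_const_along I (fun t => lorentz (grad f (alpha t)) (V1 t))].

Definition null_eikonal_V2_slant_helix (R : realType) (I : set R)
    (alpha V2 : R -> 'rV[R]_3) (f : 'rV[R]_3 -> R) : Prop :=
  [/\ null_curve I alpha, eikonal_along I alpha f &
      nonzero_const_along I (fun t => lorentz (grad f (alpha t)) (V2 t))].

Definition det3 (R : realType) (a b c : 'rV[R]_3) : R :=
  \det (\matrix_(i < 3) tnth [tuple a; b; c] i).

Lemma gradP (R : realType) (f : 'rV[R]_3 -> R) (p x : 'rV[R]_3) :
  differentiable f p -> lorentz (grad f p) x = 'D_x f p.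
Proof.
move=> df; rewrite deriveE // [in RHS](row_sum_delta x) linear_sum /=.
rewrite (eq_bigr (fun i => x 0 i * 'D_(delta_mx 0 i) f p)); last first.
  by move=> i _; rewrite linearZ /= deriveE.
rewrite !big_ord_recl big_ord0 addr0 /lorentz !mxE /= !mul1r mulN1r mulNr opprK.
rewrite addrA; congr (_ + _ + _); rewrite mulrC; congr (x 0 _ * 'D_(delta_mx 0 _) f p);
  exact: val_inj.
Qed.

Lemma covD_comp (R : realType) (alpha : R -> 'rV[R]_3)
    (Y : 'rV[R]_3 -> 'rV[R]_3) (t : R) :
  derivable alpha t 1 -> differentiable Y (alpha t) ->
  covD (Y \o alpha) t = nabla (derive1 alpha t) Y (alpha t).
Proof.
move=> /derivable1_diffP da dY.
rewrite /covD /nabla derive1E deriveE; last exact: differentiable_comp.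
by rewrite diff_comp //= deriveE // derive1E deriveE.
Qed.

(* Main.v *)
Require Import Defs.
From mathcomp Require Import all_boot all_order all_algebra.
From mathcomp Require Import all_classical all_reals all_analysis.
Import Order.TTheory GRing.Theory Num.Theory.
Import numFieldNormedType.Exports.
Local Open Scope classical_set_scope.
Local Open Scope ring_scope.

(** Since the Hessian vanishes, the gradient of [f] is a parallel field along
    [alpha] ([covD_grad_along]).  A parallel field can be moved through a
    derivative: if its product with [W] is constant along the curve, then it
    is orthogonal to the covariant derivative of [W] ([parallel_orthogonal]).

    Applied to [V1] or to [V2], whichever gives a constant product, this and
    the Frenet equations for [V1' = kappa V3] and [V2' = tau V3] show that the
    gradient is orthogonal to [V3], because [kappa] and [tau] do not vanish.
    It is therefore orthogonal to [V2' = tau V3], hence, moving it through two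
    further derivatives, to [V2''] and [V2'''].  The gradient is nonzero as its
    product with the chosen frame vector is nonzero.  The metric is
    nondegenerate, so three vectors orthogonal to one nonzero vector lie in a
    plane and their determinant vanishes ([det3_orthogonal]). *)

(** Written with the coefficients that define [grad], the metric becomes
    accessible to lemmas on finite sums. *)
Lemma lorentz_sum (R : realType) (a b : 'rV[R]_3) :
  lorentz a b =
  \sum_(i < 3) (if i == 0 then -1 else 1) * (a 0 i * b 0 i).
Proof.
rewrite !big_ord_recl big_ord0 addr0 /= mulN1r !mul1r addrA /lorentz.
by congr (_ + a 0 _ * b 0 _ + a 0 _ * b 0 _); exact: val_inj.
Qed.

Lemma lorentz0l (R : realType) (b : 'rV[R]_3) : lorentz 0 b = 0.
Proof. by rewrite lorentz_sum big1 // => i _; rewrite mxE mul0r mulr0. Qed.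

Lemma lorentzZr (R : realType) (k : R) (a b : 'rV[R]_3) :
  lorentz a (k *: b) = k * lorentz a b.
Proof.
rewrite !lorentz_sum mulr_sumr; apply: eq_bigr => i _.
by rewrite mxE 2!(mulrCA k).
Qed.

Lemma lower_index_eq0 (R : realType) (i : 'I_3) (x : R) :
  ((if i == 0 then -1 else 1) * x == 0) = (x == 0).
Proof. by case: ifP => _; rewrite ?mulN1r ?oppr_eq0 ?mul1r. Qed.

Lemma lorentz_nondegenerate (R : realType) (a : 'rV[R]_3) :
  (forall b, lorentz a b = 0) -> a = 0.
Proof.
move=> a0; apply/rowP => i; rewrite mxE; apply/eqP.
rewrite -(lower_index_eq0 _ i) -(a0 (delta_mx 0 i)) lorentz_sum (bigD1 i) //=.
rewrite big1 => [|j ji]; first by rewrite addr0 mxE !eqxx mulr1.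
by rewrite mxE (negPf ji) andbF !mulr0.
Qed.

(** Lowering the index of [n] gives a nonzero linear relation between the
    columns of the matrix with rows [a], [b] and [c]. *)
Lemma det3_orthogonal (R : realType) (n a b c : 'rV[R]_3) :
  n != 0 -> lorentz n a = 0 -> lorentz n b = 0 -> lorentz n c = 0 ->
  det3 a b c = 0.
Proof.
move=> n0 na nb nc; rewrite /det3 -det_tr; apply/eqP/det0P.
exists (\row_i ((if i == 0 then -1 else 1) * n 0 i)).
  apply: contra_neq n0 => /rowP N0; apply/rowP => i; rewrite mxE; apply/eqP.
  by rewrite -(lower_index_eq0 _ i); have := N0 i; rewrite !mxE => ->.
apply/rowP => j; rewrite !mxE.
transitivity (lorentz n (tnth [tuple a; b; c] j)).
  by rewrite lorentz_sum; apply: eq_bigr => i _; rewrite !mxE mulrA.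
by case: j => [[|[|[|//]]] Hj].
Qed.

(** This is the compatibility of the connection with the metric along a
    curve. *)
Lemma is_derive_lorentz (R : realType) (A B : R -> 'rV[R]_3) (t : R) :
  derivable A t 1 -> derivable B t 1 ->
  is_derive t 1 (fun s => lorentz (A s) (B s))
    (lorentz (covD A t) (B t) + lorentz (A t) (covD B t)).
Proof.
move=> dA dB.
have dc (W : R -> 'rV[R]_3) i : derivable W t 1 ->
    is_derive t 1 (fun s => W s 0 i) (covD W t 0 i).
  move=> dW; apply: DeriveDef; first by move/derivable_mxP: dW; exact.
  by rewrite /covD derive1E derive_mx // mxE.
have -> : (fun s => lorentz (A s) (B s)) =
    \sum_(i < 3) ((if i == 0 then -1 else 1) *:
      ((fun s => A s 0 i) * (fun s => B s 0 i))).
  by apply/funext => s; rewrite lorentz_sum fct_sumE.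
apply: is_derive_eq.
  by apply: is_derive_sum => i; apply: is_deriveZ; apply: is_deriveM; exact: dc.
rewrite !lorentz_sum -big_split /=; apply: eq_bigr => i _.
by rewrite -mulrDr addrC (mulrC (covD A t 0 i)).
Qed.

(** A constant product has derivative zero, and of the two terms of the product
    rule the one with [covD A] vanishes.  Openness of [I] makes the product
    constant near [t], so that the two-sided derivative sees nothing else. *)
Lemma parallel_orthogonal (R : realType) (I : set R) (A W : R -> 'rV[R]_3)
    (c : R) :
  open I -> (forall t, I t -> derivable A t 1) ->
  (forall t, I t -> covD A t = 0) ->
  (forall t, I t -> derivable W t 1) ->
  (forall t, I t -> lorentz (A t) (W t) = c) ->
  forall t, I t -> lorentz (A t) (covD W t) = 0.
Proof.
move=> Io dA A0 dW AW t It.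
have [_ D] := is_derive_lorentz _ _ _ _ (dA _ It) (dW _ It).
move: D; rewrite A0 // lorentz0l add0r => <-.
rewrite (near_eq_derive (g := cst c)) ?derive_cst ?oner_neq0 //.
by apply: filterS (open_nbhs_nbhs (conj Io It)) => s /AW.
Qed.

Lemma differentiable_grad (R : realType) (f : 'rV[R]_3 -> R) (p : 'rV[R]_3) :
  smooth f -> differentiable (grad f) p.
Proof.
move=> sf.
have -> : grad f = \sum_(i < 3) (fun q =>
    ((if i == 0 then -1 else 1) * 'D_(delta_mx 0 i) f q) *: delta_mx 0 i).
  apply/funext => q; rewrite fct_sumE (row_sum_delta (grad f q)).
  by apply: eq_bigr => i _; rewrite mxE.
apply: differentiable_sum => i.
have di : differentiable (fun q => 'D_(delta_mx 0 i) f q) p.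
  exact: (sf [:: delta_mx 0 i] p).
apply: differentiableZl.
by apply: differentiableM.
Qed.

(** By the chain rule this derivative is [nabla] of the gradient in the direction
    of the velocity; its products with all vectors are Hessian values, and the
    metric is nondegenerate. *)
Lemma covD_grad_along (R : realType) (alpha : R -> 'rV[R]_3)
    (f : 'rV[R]_3 -> R) (t : R) :
  smooth f -> (forall p x y, hessian f p x y = 0) -> derivable alpha t 1 ->
  derivable (grad f \o alpha) t 1 /\ covD (grad f \o alpha) t = 0.
Proof.
move=> sf H0 da; split.
  apply/derivable1_diffP/differentiable_comp; last exact: differentiable_grad.
  exact/derivable1_diffP.
rewrite covD_comp //; last exact: differentiable_grad.
exact/lorentz_nondegenerate/H0.
Qed.

Theorem theorem3p3 (R : realType) (I : set R)
    (alpha V1 V2 V3 : R -> 'rV[R]_3) (kappa tau : R -> R) (f : 'rV[R]_3 -> R)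
    (I_open : open I) (I_itv : is_interval I)
    (alpha_smooth : smooth_along I alpha)
    (alpha_null : null_curve I alpha)
    (alpha_frame : cartan_frame I alpha V1 V2 V3 kappa tau)
    (kappa_neq0 : forall t : R, I t -> kappa t != 0)
    (tau_neq0 : forall t : R, I t -> tau t != 0)
    (f_smooth : smooth f)
    (f_eikonal : eikonal_along I alpha f)
    (f_hessian0 : forall p x y : 'rV[R]_3, hessian f p x y = 0)
    (alpha_helix : null_eikonal_helix I alpha V1 f \/
                   null_eikonal_V2_slant_helix I alpha V2 f) :
  forall t : R, I t ->
    det3 (covDn 1 V2 t) (covDn 2 V2 t) (covDn 3 V2 t) = 0.
Proof.
have parallel t (It : I t) :=
  covD_grad_along _ _ _ _ f_smooth f_hessian0 (alpha_smooth 0%N t It).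
have orth W c := parallel_orthogonal _ I (grad f \o alpha) W c I_open
  (fun t It => (parallel t It).1) (fun t It => (parallel t It).2).
have grad_neq0 (W : R -> 'rV[R]_3) c t : c != 0 ->
    lorentz (grad f (alpha t)) (W t) = c -> grad f (alpha t) != 0.
  by move=> c0 E; apply: contra_neq c0 => G0; rewrite -E G0 lorentz0l.
have [G3 G0] : (forall t, I t -> lorentz (grad f (alpha t)) (V3 t) = 0) /\
    (forall t, I t -> grad f (alpha t) != 0).
  (* The helix has [k = kappa] and [W = V1], the slant helix [k = tau] and
     [W = V2]: both derivatives are multiples of [V3]. *)
  have cancel (k : R -> R) (W : R -> 'rV[R]_3) c :
      (forall t, I t -> k t != 0) -> smooth_along I W ->
      (forall t, I t -> covD W t = k t *: V3 t) ->
      (forall t, I t -> lorentz (grad f (alpha t)) (W t) = c) ->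
      forall t, I t -> lorentz (grad f (alpha t)) (V3 t) = 0.
    move=> k0 sW DW Wc t It.
    have /eqP := orth W c (sW 0%N) Wc t It.
    by rewrite DW // lorentzZr mulf_eq0 (negPf (k0 _ It)) => /eqP.
  case: alpha_helix => [[_ _ [c c0 E]]|[_ _ [c c0 E]]];
    (split; last by move=> t It; exact: grad_neq0 c0 (E t It)).
  - exact: cancel kappa_neq0 (frame_smooth1 alpha_frame) (frame_D1 alpha_frame) E.
  - exact: cancel tau_neq0 (frame_smooth2 alpha_frame) (frame_D2 alpha_frame) E.
have G_D1 t : I t -> lorentz (grad f (alpha t)) (covDn 1 V2 t) = 0.
  by move=> It; rewrite /covDn /= (frame_D2 alpha_frame) // lorentzZr G3 ?mulr0.
have smooth2 := frame_smooth2 alpha_frame.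
have G_D2 := orth (covDn 1 V2) 0 (smooth2 1%N) G_D1.
have G_D3 := orth (covDn 2 V2) 0 (smooth2 2%N) G_D2.
move=> t It.
exact: det3_orthogonal (G0 t It) (G_D1 t It) (G_D2 t It) (G_D3 t It).
Qed.
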